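(* Let $0<q<1$. For any admissible index $\boldsymbol{k}=(k_1,\dots,k_r)$ there exist positive integers $a_1,b_1,a_2,b_2,\dots,a_s,b_s$ such that $$\boldsymbol{k}=(\underbrace{a_1+1,1,\dots,1}_{b_1},\underbrace{a_2+1,1,\dots,1}_{b_2},\dots,\underbrace{a_s+1,1,\dots,1}_{b_s}),$$ where the $i$-th block has length $b_i$ and consists of $a_i+1$ followed by $b_i-1$ ones. Define the dual index $\boldsymbol{k}'=(k'_1,\dots,k'_{r'})$ of $\boldsymbol{k}$ by $$\boldsymbol{k}':=(\underbrace{b_s+1,1,\dots,1}_{a_s},\dots,\underbrace{b_2+1,1,\dots,1}_{a_2},\underbrace{b_1+1,1,\dots,1}_{a_1}),$$ where the block starting with $b_i+1$ has length $a_i$. Then for any admissible index $\boldsymbol{k}$ and any non-negative integer $l$, $$\sum_{\substack{c_1+\dots+c_r=l\\ c_i\ge 0}}\zeta_q(k_1+c_1,\dots,k_r+c_r)=\sum_{\substack{c'_1+\dots+c'_{r'}=l\\ c'_i\ge 0}}\zeta_q(k'_1+c'_1,\dots,k'_{r'}+c'_{r'}),$$ where the $c_i$ and $c'_i$ range over integers.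
   Context: Fix $0<q<1$ and let $[n]:=\frac{1-q^n}{1-q}$. An index is a finite sequence of positive integers $(k_1,\dots,k_r)$; it is admissible if $k_1\ge 2$. For an admissible index, the $q$-multiple zeta value is the absolutely convergent series $$\zeta_q(k_1,\dots,k_r):=\sum_{n_1>n_2>\dots>n_r>0}\frac{q^{n_1(k_1-1)+n_2(k_2-1)+\cdots+n_r(k_r-1)}}{[n_1]^{k_1}[n_2]^{k_2}\cdots[n_r]^{k_r}}.$$ *)

(* Defs.v *)
From HB Require Import structures.
From mathcomp Require Import all_boot all_order all_algebra.
From mathcomp Require Import all_classical all_reals all_analysis.

Set Implicit Arguments.
Unset Strict Implicit.
Unset Printing Implicit Defensive.

Import Order.TTheory GRing.Theory Num.Theory.
Local Open Scope classical_set_scope.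
Local Open Scope ring_scope.

Definition is_index (k : seq nat) : bool := all (fun x => 0 < x)%N k.

(** The default value 0 of [head] excludes the empty index. *)
Definition admissible (k : seq nat) : bool := is_index k && (2 <= head 0 k)%N.

Definition qint (R : realType) (q : R) (n : nat) : R := (1 - q ^+ n) / (1 - q).

Definition decr_seqs (r : nat) : set (seq nat) :=
  [set n | [/\ size n = r, sorted gtn n & all (fun x => 0 < x)%N n]].

(** The truncated subtraction is harmless: it is only used at entries of
    an index, which are positive. *)
Definition zetaq_term (R : realType) (q : R) (k n : seq nat) : R :=
  q ^+ (\sum_(i < size k) nth 0 n i * (nth 0 k i - 1))%N
    / \prod_(i < size k) qint q (nth 0%N n i) ^+ nth 0%N k i.

(** For [0 < q < 1] the terms are nonnegative, so the unordered sum [\esum]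
    is the sum of the absolutely convergent series; it is finite when [k] is
    admissible ([zetaq_cvg] below), so [fine] loses nothing. *)
Definition zetaq (R : realType) (q : R) (k : seq nat) : R :=
  fine (\esum_(n in decr_seqs (size k)) (zetaq_term q k n)%:E).

(** An entry [(a, b)] of [ab] encodes the block [(a + 1, 1, ..., 1)] of
    length [b]. *)
Definition of_blocks (ab : seq (nat * nat)) : seq nat :=
  flatten [seq (p.1 + 1)%N :: nseq (p.2 - 1) 1%N | p <- ab].

Definition dual_blocks (ab : seq (nat * nat)) : seq nat :=
  flatten [seq (p.2 + 1)%N :: nseq (p.1 - 1) 1%N | p <- rev ab].

Definition is_block_decomposition (k : seq nat) (ab : seq (nat * nat)) : Prop :=
  all (fun p => (0 < p.1) && (0 < p.2))%N ab /\ k = of_blocks ab.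

Definition is_dual (k k' : seq nat) : Prop :=
  exists2 ab, is_block_decomposition k ab & k' = dual_blocks ab.

(** The bound [c i <= l] built into the type of [c] only makes the index type
    finite: it follows from the constraint on the sum. *)
Definition shifted_zetaq_sum (R : realType) (q : R) (k : seq nat) (l : nat) : R :=
  \sum_(c : {ffun 'I_(size k) -> 'I_l.+1} | (\sum_i c i)%N == l)
    zetaq q [seq (nth 0 k i + c i)%N | i : 'I_(size k)].

Section Convergence.
Variables (R : realType) (q : R).
Hypotheses (q0 : 0 < q) (q1 : q < 1).

Lemma qint_ge1 n : (0 < n)%N -> 1 <= qint q n.
Proof.
move=> n0; rewrite /qint ler_pdivlMr ?subr_gt0// mul1r lerD2l lerN2.
by rewrite -[leRHS]expr1 ler_wiXn2l// ltW.
Qed.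

Lemma zetaq_term_ge0 k n : all (fun x => 0 < x)%N n -> size n = size k ->
  0 <= zetaq_term q k n.
Proof.
move=> n0 nk; rewrite /zetaq_term divr_ge0// ?exprn_ge0 ?(ltW q0)//.
apply: prodr_ge0 => i _; rewrite exprn_ge0// (le_trans ler01)// qint_ge1//.
by apply: (allP n0); rewrite mem_nth// nk.
Qed.

Lemma esum_geometric (z : R) r : 0 < z -> z < 1 ->
  (\esum_(n in [set n : seq nat | size n = r]) (\prod_(x <- n) z ^+ x)%:E < +oo)%E.
Proof.
move=> z0 z1.
have p0 n : 0 <= \prod_(x <- n) z ^+ x :> R.
  by rewrite prodr_ge0// => x _; rewrite exprn_ge0// ltW.
elim: r => [|r IH].
  rewrite (_ : [set n | _] = [set [::]]); last first.
    by apply/seteqP; split => [[]|_ ->].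
  by rewrite esum_set1 ?lee_fin// ltry.
pose S := [set n : seq nat | size n = r].
rewrite (@reindex_esum _ _ _ ([set: nat] `*`` (fun=> S)) _
  (fun p => p.1 :: p.2)); last first.
  split.
  - by move=> [x n] /= [_ <-].
  - by move=> [x n] [y m] _ _ /= [-> ->].
  - by move=> [|x n]//= [sn]; exists (x, n).
rewrite -(@esum_esum _ _ _ _ _
  (fun x n => (\prod_(y <- x :: n) z ^+ y)%:E))//; last first.
  by move=> *; rewrite lee_fin.
rewrite -(nneseries_esumT) => [|x]; last by apply: esum_ge0 => *; rewrite lee_fin.
pose C := fine (\esum_(n in S) (\prod_(x <- n) z ^+ x)%:E)%E.
have C0 : (0 <= \esum_(n in S) (\prod_(x <- n) z ^+ x)%:E)%E.
  by apply: esum_ge0 => *; rewrite lee_fin.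
have CE : (\esum_(n in S) (\prod_(x <- n) z ^+ x)%:E = C%:E)%E.
  by rewrite fineK// ge0_fin_numE.
apply: (@le_lt_trans _ _ (\sum_(x <oo) (C * z ^+ x)%:E)%E).
  apply: lee_nneseries => x.
    by move=> _ _; apply: esum_ge0 => *; rewrite lee_fin.
  move=> _; rewrite ge_ereal_sup => //= _ [X [finX XS]] <-.
  under eq_fsbigr do rewrite big_cons mulrC EFinM muleC.
  rewrite -ge0_mule_fsumr; last by move=> n; rewrite lee_fin.
  rewrite mulrC EFinM lee_wpmul2l ?lee_fin ?exprn_ge0 ?(ltW z0)// -CE.
  by apply: esum_ge; exists X.
have zn : `|z| < 1 by rewrite gtr0_norm.
have cl := @cvg_geometric_series R C z zn.
rewrite (_ : (\sum_(x <oo) _)%E = (C * (1 - z)^-1)%:E) ?ltry//.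
apply: cvg_lim => //; apply: cvg_EFin; first by near=> n; rewrite sumEFin.
apply: cvg_trans cl; apply: near_eq_cvg; near=> n.
by rewrite /= sumEFin.
Unshelve. all: by end_near. Qed.

Lemma zetaq_cvg k : admissible k ->
  (\esum_(n in decr_seqs (size k)) (zetaq_term q k n)%:E < +oo)%E.
Proof.
case: k => [|k1 k]//; rewrite /admissible => /andP[_ /= k1_ge2].
set r := (size k).+1.
pose z := q `^ (r%:R^-1).
have z0 : 0 < z by exact: powR_gt0.
have zr : z ^+ r = q.
  by rewrite -powR_mulrn ?powR_ge0// /z -powRrM mulVf ?pnatr_eq0// powRr1// ltW.
have z1 : z < 1 by rewrite -(@expr_lt1 _ r)// ?zr// ltW.
apply: le_lt_trans (@esum_geometric z r z0 z1).
apply: (@le_trans _ _ (\esum_(n in decr_seqs r) (\prod_(x <- n) z ^+ x)%:E)%E);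
    last first.
  by apply: ereal_sup_le => _ [X [fX XS] <-]; exists X => //; split => // n /XS [].
apply: le_esum => n [sn so n0]; rewrite lee_fin.
rewrite /zetaq_term -[leRHS]mulr1 ler_pM//.
- by rewrite exprn_ge0// ltW.
- rewrite invr_ge0 prodr_ge0// => i _; rewrite exprn_ge0// (le_trans ler01)//.
  by rewrite qint_ge1//; apply: (allP n0); rewrite mem_nth// sn.
- rewrite -expr_sum -zr -exprM ler_wiXn2l ?(ltW z0) ?(ltW z1)//=.
  case: n sn so n0 => // n1 n /= [sn] so _.
  rewrite big_ord_recl/= big_cons.
  have le1 : (\sum_(x <- n) x <= size k * n1)%N.
    rewrite -sn -sum1_size big_distrl/= big_seq [leqRHS]big_seq.
    apply: leq_sum => x xn; rewrite mul1n.
    have := order_path_min (rev_trans ltn_trans) so.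
    by move=> /allP/(_ _ xn)/ltnW.
  apply: (@leq_trans (r * n1)); first by rewrite /r mulSn leq_add2l.
  rewrite leq_mul2l /=.
  rewrite (leq_trans _ (leq_addr _ _))// leq_pmulr// subn_gt0//.
- suff p1 : 1 <= \prod_(i < r) qint q (nth 0%N n i) ^+ nth 0%N (k1 :: k) i.
    by rewrite invf_le1// (lt_le_trans ltr01).
  apply: (big_ind (fun x => 1 <= x)) => // [x y x1 y1|i _].
    by rewrite -[leLHS]mulr1 ler_pM.
  by rewrite exprn_ege1// qint_ge1//; apply: (allP n0); rewrite mem_nth// sn.
Qed.
End Convergence.

(* Main.v *)
(** Connected sums (Seki-Yamamoto).  For [0 <= x < 1] summing the geometric series
    in each [c_i] turns the generating function [\sum_l x^l S_l(k)] of the shifted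
    sums into the nested sum with weights
    [w(k, n) = q^(n(k-1)) / ([n]^(k-1) ([n] - x q^n))].  Two such sums, over
    [n_1 > n_2 > ...] and [m_1 > m_2 > ...], are joined by the connector
    [q^(n_1 m_1) f(n_1) f(m_1) / f(n_1 + m_1)] with
    [f(n) = \prod_(1 <= h <= n) ([h] - x q^h)].  A telescoping identity shows that
    the connected sum is unchanged when [(k_1 + 1, k; l)] is replaced by
    [(k_1, k; 1, l)]; with the symmetry in [k] and [l] this moves the blocks of
    [k] one at a time to the right, where they arrive dualized.  So the two
    generating functions agree on [0, 1[, hence so do their coefficients. *)

Require Import Defs.
From mathcomp Require Import all_boot all_order all_algebra.
From mathcomp Require Import all_classical all_reals all_analysis.
From mathcomp Require Import finmap ring lra.

Set Implicit Arguments.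
Unset Strict Implicit.
Unset Printing Implicit Defensive.

Import Order.TTheory GRing.Theory Num.Theory.
Import numFieldNormedType.Exports.
Local Open Scope classical_set_scope.
Local Open Scope ring_scope.

(** * Unordered sums of nonnegative terms *)

Lemma esum_interchange (R : realType) (T1 T2 : choiceType) (I : set T1)
    (J : set T2) (a : T1 -> T2 -> \bar R) :
  (forall i j, I i -> J j -> (0 <= a i j)%E) ->
  (\esum_(i in I) \esum_(j in J) a i j = \esum_(j in J) \esum_(i in I) a i j)%E.
Proof.
move=> a0; rewrite esum_esum// esum_esum; last by move=> *; exact: a0.
apply: (@reindex_esum _ _ _ (J `*`` fun=> I)%classic _
  (fun p : T2 * T1 => (p.2, p.1))); split.
- by move=> [j i] /= [].
- by move=> [j i] [j' i'] _ _ /= [-> ->].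
- by move=> [i j] /= [Ii Jj]; exists (j, i).
Qed.

Lemma esumZl (R : realType) (T : choiceType) (I : set T) (x : R)
    (a : T -> \bar R) : 0 <= x -> (forall i, I i -> (0 <= a i)%E) ->
  (\esum_(i in I) (x%:E * a i) = x%:E * \esum_(i in I) a i)%E.
Proof.
rewrite le_eqVlt => /orP[/eqP <- _|x0 a0].
  by rewrite mul0e esum1// => i _; rewrite mul0e.
have scale_le (y : R) (b : T -> \bar R) : 0 < y ->
    (forall i, I i -> (0 <= b i)%E) ->
    (\esum_(i in I) (y%:E * b i) <= y%:E * \esum_(i in I) b i)%E.
  move=> y0 b0; rewrite ge_ereal_sup// => _ [X [finX XI] <-].
  rewrite fsbig_finite// big_seq; have bX i : i \in fset_set X -> (0 <= b i)%E.
    by rewrite in_fset_set// => /set_mem/XI/b0.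
  rewrite -ge0_sume_distrr// -big_seq -fsbig_finite// lee_pmul2l//.
  by apply: esum_ge; exists X.
apply/eqP; rewrite eq_le scale_le//=.
(* The reverse inequality is [scale_le] again, for the factor [x^-1] and the terms [x%:E * a i]. *)
rewrite -[leRHS]mul1e -(divff (lt0r_neq0 x0)) EFinM -muleA lee_pmul2l//.
have -> : (esum I a = \esum_(i in I) (x^-1%:E * (x%:E * a i)))%E.
  by apply: eq_esum => i _; rewrite muleA -EFinM mulVf ?mul1e// gt_eqF.
apply: scale_le; first by rewrite invr_gt0.
by move=> i Ii; rewrite mule_ge0 ?a0// lee_fin ltW.
Qed.

Lemma esum_fibers (R : realType) (T1 T2 : choiceType) (I : set T1)
    (J : set T2) (h : T1 -> T2) (a : T1 -> \bar R) :
  (forall i, I i -> J (h i)) -> (forall i, I i -> (0 <= a i)%E) ->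
  (\esum_(i in I) a i =
   \esum_(j in J) \esum_(i in [set i | I i /\ h i = j]%classic) a i)%E.
Proof.
move=> IJ a0; rewrite esum_esum; last by move=> j i _ /= [/a0].
apply: (@reindex_esum _ _ _ (J `*`` fun j => [set i | I i /\ h i = j])%classic _
  (fun p : T2 * T1 => p.2)); split.
- by move=> [j i] /= [_ []].
- by move=> [j i] [j' i'] /set_mem/= [_ [_ <-]] /set_mem/= [_ [_ <-]] ->.
- by move=> i Ii; exists (h i, i) => //=; split => //; exact: IJ.
Qed.

Lemma esum_cvg_series (R : realType) (a : nat -> R) (s : R) :
  (forall n, 0 <= a n) -> series a @ \oo --> s ->
  (\esum_(n in [set: nat]) (a n)%:E = s%:E)%E.
Proof.
move=> a0 sa; rewrite -nneseries_esumT => [|n]; last by rewrite lee_fin.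
apply: cvg_lim => //; apply: cvg_EFin; first by near=> n; rewrite sumEFin.
by apply: cvg_trans sa; apply: near_eq_cvg; near=> n; rewrite /= sumEFin.
Unshelve. all: by end_near. Qed.

Lemma esum_ord (R : realType) m (a : nat -> \bar R) :
  (forall n, (n < m)%N -> (0 <= a n)%E) ->
  (\esum_(n in [set n | (n < m)%N]%classic) a n = \sum_(n < m) a n)%E.
Proof.
move=> a0; rewrite esum_fset ?fsbig_ord//.
by move=> i /set_mem/a0.
Qed.

(** * Sums over decreasing sequences as nested sums *)

(** This is the part of the multiple sum whose largest variable equals [n]. The empty sequence
    counts as having largest variable 0, so the inner sum over [m < n] reaches it exactly when [n]
    is positive. *)
Fixpoint nested (R : pzRingType) (v : nat -> nat -> R) (k : seq nat) (n : nat) : R :=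
  if k is k1 :: k' then v k1 n * \sum_(m < n) nested v k' m else (n == 0%N)%:R.

Lemma nested0 (R : pzRingType) (v : nat -> nat -> R) k1 k :
  nested v (k1 :: k) 0 = 0.
Proof. by rewrite /= big_ord0 mulr0. Qed.

Lemma nested_ge0 (R : numDomainType) (v : nat -> nat -> R) k n :
  (forall k n, (0 < n)%N -> 0 <= v k n) -> 0 <= nested v k n.
Proof.
move=> v0; elim: k n => [|k1 k IH] n /=; first by rewrite ler0n.
have [->|n0] := posnP n; first by rewrite big_ord0 mulr0.
by rewrite mulr_ge0 ?v0 ?sumr_ge0.
Qed.

(** The default 0 of [head] makes the comparison with [m] automatic for an empty tail. *)
Lemma decr_seqs_cons r m n : (0 < m)%N ->
  (decr_seqs r.+1 (m :: n) <-> decr_seqs r n /\ (head 0 n < m)%N)%N.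
Proof.
move=> m0; split.
  case: n => [|n1 n] [] //=; first by move=> [<-].
  move=> [<-] /andP[mn sn] /andP[_ n0]; split => //.
case: n => [|n1 n] [[/= <- so n0] nm]; split=> //=; first by rewrite m0.
  by rewrite so [(m > n1)%N]nm.
by rewrite m0.
Qed.

Lemma esum_decr_seqs (R : realType) (v : nat -> nat -> R) k :
  (forall k n, (0 < n)%N -> 0 <= v k n) ->
  (\esum_(n in decr_seqs (size k))
     (\prod_(i < size k) v (nth 0 k i) (nth 0 n i))%:E =
   \esum_(n in [set: nat]) (nested v k n)%:E)%E.
Proof.
move=> v0.
have p0 k' n : decr_seqs (size k') n ->
    (0 <= (\prod_(i < size k') v (nth 0 k' i)%N (nth 0 n i)%N)%:E)%E.
  move=> [sn _ n0]; rewrite lee_fin prodr_ge0// => i _; rewrite v0//.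
  by apply: (allP n0); rewrite mem_nth ?sn.
(* Sorting the sequences by their first entry, which is the largest, reproduces the recursion of
   [nested]; the tails are sorted in the same way below. *)
rewrite (@esum_fibers _ _ _ _ [set: nat] (head 0%N))//; last by move=> n; exact: p0.
apply: eq_esum => m _; elim: k m => [|k1 k IH] m.
  have [->|m0] := eqVneq m 0%N => /=.
    rewrite (_ : [set _ | _]%classic = [set [::]]%classic) ?esum_set1//.
    - by rewrite big_ord0.
    - by rewrite lee_fin big_ord0.
    - by apply/seteqP; split => [n [[/size0nil->]]|_ ->].
  rewrite (_ : [set _ | _]%classic = set0) ?esum_set0 ?(negbTE m0)//.
  by apply/seteqP; split => // -[|? ?] /= [[//= _ _ _] mE]; rewrite mE eqxx in m0.
have [->|m0] := posnP m.
  rewrite nested0 (_ : [set _ | _]%classic = set0) ?esum_set0//.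
  by apply/seteqP; split => // -[|? ?] /= [[//= _ _ +] mE]; rewrite mE.
rewrite (@reindex_esum _ _ _
  [set n | decr_seqs (size k) n /\ (head 0 n < m)%N]%classic _ (cons m)); last first.
  split.
  - by move=> n /= nk; split => //; exact/decr_seqs_cons.
  - by move=> n n' _ _ [].
  - by move=> [|x n] /= [[]// ? ? ?] xm; exists n; subst x => //; apply/decr_seqs_cons.
under eq_esum.
  move=> n _; rewrite big_ord_recl /= EFinM; over.
rewrite esumZl ?v0//; last by move=> n [] nk _; exact: p0.
rewrite EFinM -sumEFin; congr (_ * _)%E.
rewrite (@esum_fibers _ _ _ _ [set i | (i < m)%N]%classic (head 0%N))//.
- rewrite esum_ord => [|i _]; last by apply: esum_ge0 => n [[nk _] _]; exact: p0.
  apply: eq_bigr => i _; rewrite -IH; congr esum.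
  apply/seteqP; split => n /=; first by move=> [[nk nm] ni].
  by move=> [nk ->].
- by move=> n [].
- by move=> n [nk _]; exact: p0.
Qed.

(** * Summing over the shifts [c] turns zeta weights into Ohno weights *)

Section Weights.
Variables (R : realType) (q : R).
Hypotheses (q0 : 0 < q) (q1 : q < 1).

Definition zeta_weight (k n : nat) : R := q ^+ (n * (k - 1)) / qint q n ^+ k.

Definition qintx (x : R) (n : nat) : R := qint q n - x * q ^+ n.

Definition ohno_weight (x : R) (k n : nat) : R :=
  q ^+ (n * (k - 1)) / (qint q n ^+ (k - 1) * qintx x n).

Definition addseq (k c : seq nat) : seq nat := [seq (p.1 + p.2)%N | p <- zip k c].

Lemma qintD m n : qint q (m + n) = qint q m + q ^+ m * qint q n.
Proof.
have q1' : 1 - q != 0 by rewrite subr_eq0 gt_eqF.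
by rewrite /qint exprD; field.
Qed.

Lemma qint_gt0 n : (0 < n)%N -> 0 < qint q n.
Proof. by move=> n0; rewrite (lt_le_trans ltr01)// qint_ge1. Qed.

Lemma zeta_weight_ge0 k n : (0 < n)%N -> 0 <= zeta_weight k n.
Proof.
by move=> n0; apply: divr_ge0; rewrite exprn_ge0 ?(ltW q0) ?(ltW (qint_gt0 n0)).
Qed.

Lemma zetaq_termE k n :
  zetaq_term q k n = \prod_(i < size k) zeta_weight (nth 0 k i)%N (nth 0 n i)%N.
Proof. by rewrite /zetaq_term expr_sum -prodf_div. Qed.

Lemma size_addseq k c : size c = size k -> size (addseq k c) = size k.
Proof. by move=> ck; rewrite size_map size_zip ck minnn. Qed.

Lemma esum_zetaq_term k :
  (\esum_(n in decr_seqs (size k)) (zetaq_term q k n)%:E =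
   \esum_(n in [set: nat]) (nested zeta_weight k n)%:E)%E.
Proof.
rewrite -esum_decr_seqs; last exact: zeta_weight_ge0.
by apply: eq_esum => n _; rewrite zetaq_termE.
Qed.

Section OhnoWeight.
Variable (x : R).
Hypotheses (x0 : 0 <= x) (x1 : x < 1).

Lemma qintx_gt0 n : (0 < n)%N -> 0 < qintx x n.
Proof.
move=> n0; rewrite subr_gt0 (lt_le_trans _ (qint_ge1 q0 q1 n0))//.
by rewrite (le_lt_trans _ x1)// ler_piMr// exprn_ile1 ?ltW.
Qed.

Lemma ohno_weight_ge0 k n : (0 < n)%N -> 0 <= ohno_weight x k n.
Proof.
move=> n0; apply: divr_ge0; first by rewrite exprn_ge0 ?(ltW q0).
by apply: mulr_ge0; rewrite ?exprn_ge0 ?(ltW (qint_gt0 n0)) ?(ltW (qintx_gt0 n0)).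
Qed.

(** A geometric series of ratio [x * q ^+ n / qint q n], which is below 1 because [qintx q x n] is
    positive. *)
Lemma esum_zeta_weight_shift k n : (0 < k)%N -> (0 < n)%N ->
  (\esum_(c in [set: nat]) (x ^+ c * zeta_weight (k + c) n)%:E =
   (ohno_weight x k n)%:E)%E.
Proof.
move=> k0 n0; have n_gt0 := qint_gt0 n0.
have z1 : x * q ^+ n / qint q n < 1.
  by rewrite ltr_pdivrMr// mul1r -subr_gt0 qintx_gt0.
have z0 : 0 <= x * q ^+ n / qint q n.
  by apply: divr_ge0 (ltW n_gt0); rewrite mulr_ge0 ?exprn_ge0 ?(ltW q0).
rewrite (_ : ohno_weight x k n =
    zeta_weight k n * (1 - x * q ^+ n / qint q n)^-1); last first.
  rewrite /ohno_weight /zeta_weight; case: k k0 => // k _.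
  rewrite subn1/= exprS /qintx; field; rewrite ?expf_neq0 ?gt_eqF//.
  rewrite subr_gt0 mulrC; move: z1; rewrite ltr_pdivrMr// mul1r mulrC//.
apply: esum_cvg_series.
  by move=> c; rewrite mulr_ge0 ?exprn_ge0 ?zeta_weight_ge0.
rewrite (_ : (fun c => x ^+ c * zeta_weight (k + c) n) =
    geometric (zeta_weight k n) (x * q ^+ n / qint q n)).
  by apply: cvg_geometric_series; rewrite ger0_norm.
apply/funext => c /=; rewrite /zeta_weight.
move: (qint q n) n_gt0 => N N_gt0.
rewrite -addnBAC// mulnDr !exprD !exprMn exprVn -exprM.
by field; rewrite !expf_neq0 ?gt_eqF.
Qed.

(** By induction on [k]: the shift of the first entry is summed by the geometric series, the other
    shifts by the induction hypothesis. *)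
Lemma esum_nested_shift k n : is_index k ->
  (\esum_(c in [set c | size c = size k])
     (x ^+ sumn c * nested zeta_weight (addseq k c) n)%:E =
   (nested (ohno_weight x) k n)%:E)%E.
Proof.
have x_ge0 c k' m : (0 <= (x ^+ c * nested zeta_weight k' m)%:E)%E.
  by rewrite lee_fin mulr_ge0 ?exprn_ge0 ?nested_ge0//; exact: zeta_weight_ge0.
elim: k n => [|k1 k IH] n.
  rewrite (_ : [set _ | _] = [set [::]]) => [_|].
    by rewrite esum_set1// mul1r.
  by apply/seteqP; split => [c /size0nil|_ ->].
have [-> _|n0] := posnP n.
  rewrite nested0 esum1// => -[//|c1 c] _.
  by rewrite /addseq [zip _ _]/= map_cons nested0 mulr0.
rewrite /is_index /= -/(is_index k) => /andP[k1_gt0 kidx].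
rewrite (@reindex_esum _ _ _ ([set: nat] `*`` (fun=> [set c | size c = size k])) _
  (fun p => p.1 :: p.2)); last first.
  split.
  - by move=> [c1 c] /= [_ <-].
  - by move=> [c1 c] [d1 d] _ _ /= [-> ->].
  - by move=> [|c1 c]//= [sc]; exists (c1, c).
rewrite -(@esum_esum _ _ _ _ _ (fun c1 c =>
   (x ^+ sumn (c1 :: c) * nested zeta_weight (addseq (k1 :: k) (c1 :: c)) n)%:E))//.
(* Once the shifts of the tail are summed, their contribution no longer depends on [c1] and comes
   out as a constant factor. *)
transitivity (\esum_(c1 in [set: nat])
   ((\sum_(m < n) nested (ohno_weight x) k m)%:E *
    (x ^+ c1 * zeta_weight (k1 + c1) n)%:E))%E.
  apply: eq_esum => c1 _; rewrite muleC.
  rewrite -sumEFin; under [in RHS]eq_bigr do rewrite -IH//.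
  rewrite -esum_sum// -esumZl; last 2 first.
  - by rewrite mulr_ge0 ?exprn_ge0 ?zeta_weight_ge0.
  - by move=> *; rewrite sume_ge0.
  apply: eq_esum => c _ /=; rewrite sumEFin -EFinM exprD -mulr_sumr.
  by rewrite mulrACA.
rewrite esumZl ?esum_zeta_weight_shift//.
- by rewrite -EFinM mulrC.
- by rewrite sumr_ge0// => m _; rewrite nested_ge0//; exact: ohno_weight_ge0.
- by move=> c _; rewrite lee_fin mulr_ge0 ?exprn_ge0 ?zeta_weight_ge0.
Qed.

Lemma esum_shifted_zetaq_terms k : is_index k ->
  (\esum_(c in [set c | size c = size k]) ((x ^+ sumn c)%:E *
     \esum_(n in decr_seqs (size k)) (zetaq_term q (addseq k c) n)%:E) =
   \esum_(n in [set: nat]) (nested (ohno_weight x) k n)%:E)%E.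
Proof.
move=> kidx; have nz0 k' n : 0 <= nested zeta_weight k' n.
  by rewrite nested_ge0//; exact: zeta_weight_ge0.
under [in RHS]eq_esum do rewrite -esum_nested_shift//.
rewrite esum_interchange; last first.
  by move=> n c _ _; rewrite lee_fin mulr_ge0 ?exprn_ge0.
apply: eq_esum => c /= ck; rewrite -{1}(size_addseq ck) esum_zetaq_term.
by rewrite -esumZl ?exprn_ge0// => n _; rewrite lee_fin.
Qed.

End OhnoWeight.
End Weights.

(** * Connected sums and the transport of blocks *)

Section ConnectedSum.
Variables (R : realType) (q x : R).
Hypotheses (q0 : 0 < q) (q1 : q < 1) (x0 : 0 <= x) (x1 : x < 1).

Let qintx_gt0' n : (0 < n)%N -> 0 < qintx q x n.
Proof. exact: qintx_gt0. Qed.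

(** A deformed q-factorial: at [x = 0] it is the usual one, and [connector n m] is then
    [q ^+ (n * m)] divided by a q-binomial coefficient. *)
Definition qfactx (n : nat) : R := \prod_(h < n) qintx q x h.+1.

Definition connector (n m : nat) : R :=
  q ^+ (n * m) * qfactx n * qfactx m / qfactx (n + m).

Lemma qfactx_gt0 n : 0 < qfactx n.
Proof. by apply: prodr_gt0 => h _; exact: qintx_gt0'. Qed.

Lemma connectorC n m : connector n m = connector m n.
Proof. by rewrite /connector mulnC addnC (mulrAC _ (qfactx n)). Qed.

Lemma connector0 n : connector n 0 = 1.
Proof.
rewrite /connector muln0 addn0 mul1r {2}/qfactx big_ord0 mulr1 divff//.
by rewrite gt_eqF// qfactx_gt0.
Qed.

Lemma connector_ge0 n m : 0 <= connector n m.
Proof.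
apply: divr_ge0; last by rewrite ltW ?qfactx_gt0.
apply: mulr_ge0; last by rewrite ltW ?qfactx_gt0.
by apply: mulr_ge0; rewrite ?exprn_ge0 ?(ltW q0) ?(ltW (qfactx_gt0 _)).
Qed.

Lemma qintxD n m : qintx q x (n + m) = qint q n + q ^+ n * qintx q x m.
Proof. by rewrite /qintx qintD// exprD; ring. Qed.

Lemma connectorS n m :
  connector n m.+1 * qintx q x (n + m.+1) = connector n m * (q ^+ n * qintx q x m.+1).
Proof.
have s0 := qintx_gt0' (ltn0Sn (n + m)).
have p0 := qfactx_gt0 (n + m).
rewrite /connector mulnS exprD addnS.
rewrite [qfactx m.+1]big_ord_recr [qfactx (n + m).+1]big_ord_recr /=.
rewrite -!/(qfactx _).
by field; rewrite !gt_eqF.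
Qed.

(* This makes the sum in [esum_connector] telescope. *)
Lemma connectorB n m : q ^+ n * (connector n m - connector n m.+1) =
  qint q n * (connector n m.+1 / qintx q x m.+1).
Proof.
have t0 := qintx_gt0' (ltn0Sn m).
have := connectorS n m; rewrite qintxD mulrDr => cS.
apply: (mulIf (lt0r_neq0 t0)); rewrite -[RHS]mulrA divfK ?gt_eqF//.
rewrite (_ : q ^+ n * _ * _ = connector n m * (q ^+ n * qintx q x m.+1) -
  connector n m.+1 * (q ^+ n * qintx q x m.+1)); last by ring.
by rewrite -cS addrK mulrC.
Qed.

(** Since [qintx q x] is increasing, [connectorS] shows that each step in [m] costs a factor at most
    [q ^+ n]. The bound makes the boundary term of the telescoping sum vanish in the limit. *)
Lemma connector_le n m : connector n m <= q ^+ (n * m).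
Proof.
elim: m => [|m IH]; first by rewrite connector0 muln0.
have t0 := qintx_gt0' (ltn0Sn m).
have s0 := qintx_gt0' (ltn0Sn (n + m)); rewrite -addnS in s0.
have ts : qintx q x m.+1 <= qintx q x (n + m.+1).
  rewrite addnC qintxD {1}/qintx lerD2l mulrC -mulrN ler_pM2l ?exprn_gt0//.
  rewrite /qintx -[leLHS]add0r lerB//.
    have [->|n0] := posnP n; first by rewrite /qint subrr mul0r.
    by rewrite ltW ?qint_gt0.
  by rewrite ler_piMr// exprn_ile1 ?ltW.
rewrite -(ler_pM2r s0) connectorS mulnSr exprD -[leRHS]mulrA.
apply: ler_pM => //; first exact: connector_ge0.
  by apply: mulr_ge0 (ltW t0); rewrite exprn_ge0 ?(ltW q0).
by rewrite ler_pM2l ?exprn_gt0.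
Qed.

(** By [connectorB] the terms are [q ^+ n / qint q n] times differences of consecutive connectors,
    and the connectors tend to 0. *)
Lemma esum_connector n m : (0 < n)%N ->
  (\esum_(b in [set: nat])
     (if (m < b)%N then connector n b / qintx q x b else 0)%:E =
   (q ^+ n / qint q n * connector n m)%:E)%E.
Proof.
move=> n0; have N0 := qint_gt0 q0 q1 n0.
apply: esum_cvg_series => [b|].
  case: ifP => // mb; apply: divr_ge0; first exact: connector_ge0.
  by rewrite ltW ?qintx_gt0' ?(leq_ltn_trans _ mb).
(* The partial sum stops at [b = N.-1]; the maximum with [m] covers the range where no term has
   entered yet. *)
have partial N : series (fun b => if (m < b)%N then connector n b / qintx q x b
    else 0) N = q ^+ n / qint q n * (connector n m - connector n (maxn m N.-1)).
  rewrite /series /=; elim: N => [|N IH].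
    by rewrite big_geq// maxn0 subrr mulr0.
  rewrite big_nat_recr//= IH; case: N {IH} => [|N] /=.
    by rewrite maxn0 subrr mulr0 addr0.
  case: ifPn => mN; last first.
    by rewrite -leqNgt in mN; rewrite addr0 (maxn_idPl mN) (maxn_idPl (ltnW mN)).
  rewrite (maxn_idPr (ltnW mN)) (@maxn_idPr m N mN).
  rewrite -(mulKf (lt0r_neq0 N0) (connector n N.+1 / _)) -connectorB.
  by move: (qint q n) => y; ring.
rewrite (_ : series _ = (fun N => q ^+ n / qint q n *
    (connector n m - connector n (maxn m N.-1)))); last exact/funext.
suff c0 : (fun N => connector n (maxn m N.-1)) @ \oo --> (0 : R).
  rewrite -[connector n m in X in _ --> X]subr0.
  by apply: cvgM; [exact: cvg_cst|apply: cvgB c0; exact: cvg_cst].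
(* The factor [q^-1] compensates for the predecessor in [N.-1]. *)
apply: (@squeeze_cvgr _ _ _ _ (fun=> 0) (geometric q^-1 q)).
- apply: nearW => N; rewrite connector_ge0/= (le_trans (connector_le _ _))//.
  rewrite mulrC ler_pdivlMr// -exprSr ler_wiXn2l ?(ltW q0) ?(ltW q1)//.
  by rewrite (leq_trans (leqSpred _))// ltnS (leq_trans (leq_maxr m _))// leq_pmull.
- exact: cvg_cst.
- by apply: cvg_geometric; rewrite gtr0_norm.
Qed.

Let weight := ohno_weight q x.

(** Valued in [\bar R], so that the nonnegative sums can be rearranged before their finiteness is
    established. *)
Definition connected_sum (k l : seq nat) : \bar R :=
  (\esum_(n in [set: nat]) \esum_(m in [set: nat])
     (nested weight k n * connector n m * nested weight l m)%:E)%E.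

Let nested_weight_ge0 k n : 0 <= nested weight k n.
Proof. by apply: nested_ge0 => *; exact: ohno_weight_ge0. Qed.

Let summand_ge0 k l n m :
  (0 <= (nested weight k n * connector n m * nested weight l m)%:E)%E.
Proof.
rewrite lee_fin; apply: mulr_ge0 => //; apply: mulr_ge0 => //.
exact: connector_ge0.
Qed.

Lemma connected_sumC k l : connected_sum k l = connected_sum l k.
Proof.
rewrite /connected_sum esum_interchange//; apply: eq_esum => m _.
by apply: eq_esum => n _; rewrite connectorC; congr EFin; ring.
Qed.

(** The empty index forces [m = 0], where the connector is 1. *)
Lemma connected_sum_nil k :
  (connected_sum k [::] = \esum_(n in [set: nat]) (nested weight k n)%:E)%E.
Proof.
apply: eq_esum => n _.
transitivity (\esum_(m in [set 0%N])
    (nested weight k n * connector n m * nested weight [::] m)%:E)%E.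
  rewrite [RHS]esum_mkcond; apply: eq_esum => m _.
  case: ifPn => //; rewrite notin_setE /= => /eqP m0.
  by rewrite (negbTE m0) mulr0.
rewrite esum_set1; last exact: summand_ge0.
by rewrite connector0 !mulr1.
Qed.

Lemma nested_weightS k1 k n : (0 < k1)%N ->
  nested weight (k1.+1 :: k) n = q ^+ n / qint q n * nested weight (k1 :: k) n.
Proof.
case: k1 => // k1 _; have [->|n0] := posnP n; first by rewrite !nested0 mulr0.
have N0 := qint_gt0 q0 q1 n0; have M0 := qintx_gt0' n0.
rewrite /= /weight /ohno_weight !subn1 /= mulnS exprD exprS.
move: N0 M0; move: (qint q n) (qintx q x n) => N M N0 M0.
by field; rewrite ?expf_neq0 ?gt_eqF.
Qed.

Lemma nested_weight1 l n : (0 < n)%N ->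
  nested weight (1%N :: l) n = (\sum_(m < n) nested weight l m) / qintx q x n.
Proof. by move=> n0; rewrite /= /weight /ohno_weight muln0 !expr0 !mul1r mulrC. Qed.

(** Lowering [k1.+1] to [k1] frees a factor [q ^+ n / qint q n], which [esum_connector] converts
    into a sum over [b > m]. This [b] is the new largest variable on the right, and
    [1 / qintx q x b] is its weight for the entry 1. *)
Lemma connected_sum_transport k1 k l : (0 < k1)%N ->
  connected_sum (k1.+1 :: k) l = connected_sum (k1 :: k) (1%N :: l).
Proof.
move=> k1_gt0; apply: eq_esum => n _.
have [->|n0] := posnP n.
  by rewrite !esum1// => m _; rewrite nested0 !mul0r.
pose T b := connector n b / qintx q x b.
have T0 m b : 0 <= (if (m < b)%N then T b else 0).
  case: ifP => // mb; apply: divr_ge0; first exact: connector_ge0.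
  by rewrite ltW ?qintx_gt0' ?(leq_ltn_trans _ mb).
pose A := nested weight (k1 :: k) n.
transitivity (\esum_(m in [set: nat]) \esum_(b in [set: nat])
    (A * nested weight l m * (if (m < b)%N then T b else 0))%:E)%E.
  apply: eq_esum => m _; under [RHS]eq_esum do rewrite EFinM.
  have Al0 : 0 <= A * nested weight l m by apply: mulr_ge0; exact: nested_weight_ge0.
  rewrite (esumZl Al0); last by move=> b _; exact: T0.
  rewrite esum_connector// nested_weightS// -EFinM -/A; congr EFin.
  by ring.
rewrite esum_interchange => [|m b _ _]; last first.
  rewrite lee_fin; apply: mulr_ge0 (T0 _ _).
  by apply: mulr_ge0; exact: nested_weight_ge0.
apply: eq_esum => b _; have [->|b0] := posnP b.
  by rewrite nested0 mulr0 esum1// => m _; rewrite ltn0 mulr0.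
transitivity (\esum_(m in [set m | (m < b)%N]) (A * nested weight l m * T b)%:E)%E.
  rewrite [RHS]esum_mkcond; apply: eq_esum => m _.
  have -> : (m \in [set m | (m < b)%N]) = (m < b)%N by apply/idP/idP => [/set_mem|/mem_set].
  by case: ifPn; rewrite ?mulr0.
rewrite esum_ord => [|m mb].
  rewrite sumEFin nested_weight1//; congr EFin.
  by rewrite -big_distrl -big_distrr /T -/A /=; ring.
rewrite lee_fin; apply: mulr_ge0; last by have := T0 m b; rewrite mb.
by apply: mulr_ge0; exact: nested_weight_ge0.
Qed.

Lemma connected_sum_ones a k l :
  connected_sum (a.+1 :: k) l = connected_sum (1%N :: k) (nseq a 1%N ++ l).
Proof.
elim: a l => [//|a IH] l; rewrite connected_sum_transport// IH.
by congr (connected_sum _ _); elim: a {IH} => //= a ->.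
Qed.

(** Transport read backwards with the two sides exchanged: each leading 1 on the left raises the
    first entry on the right. *)
Lemma connected_sum_absorb b j k l :
  connected_sum (nseq b 1%N ++ k) (j.+1 :: l) = connected_sum k ((j + b).+1 :: l).
Proof.
elim: b j => [|b IH] j; first by rewrite addn0.
by rewrite /= connected_sumC -connected_sum_transport// connected_sumC IH addSnnS.
Qed.

Lemma connected_sum_blocks ab l : all (fun p => (0 < p.1) && (0 < p.2))%N ab ->
  connected_sum (of_blocks ab) l = connected_sum [::] (dual_blocks ab ++ l).
Proof.
elim: ab l => [//|[a b] ab IH] l /= /andP[/andP[a0 b0] ab0].
case: a a0 => // a _; case: b b0 => // b _.
have -> : of_blocks ((a.+1, b.+1) :: ab) = a.+2 :: nseq b 1%N ++ of_blocks ab.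
  by rewrite /of_blocks/= addn1 subn1.
have -> : dual_blocks ((a.+1, b.+1) :: ab) = dual_blocks ab ++ b.+2 :: nseq a 1%N.
  by rewrite /dual_blocks rev_cons map_rcons flatten_rcons/= addn1 subn1.
(* The first entry drops to 1 and sends [a.+1] ones to the right. The [b.+1] ones now leading on the
   left are absorbed by the first of these, giving the dual block; later blocks land in front of it,
   hence the reversed order. *)
rewrite connected_sum_ones (connected_sum_absorb b.+1 0) add0n.
by rewrite IH// -catA.
Qed.

End ConnectedSum.

(** * Equality of power series coefficients *)

Lemma esum_big_enum (R : realType) (T : finType) (P : pred T) (a : T -> \bar R) :
  (forall i, P i -> (0 <= a i)%E) ->
  (\esum_(i in [set i | P i]) a i = \sum_(i | P i) a i)%E.
Proof.
move=> a0; transitivity (\sum_(i in P) a i)%E; last by [].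
rewrite -big_enum /= fsbig_seq ?enum_uniq//.
have -> : [set i | P i] = [set` enum P].
  by apply/seteqP; split => i /=; rewrite mem_enum.
rewrite esum_fset//.
by move=> i /set_mem/=; rewrite mem_enum; exact: a0.
Qed.

(* As [x] tends to [0], comparing the two sums beyond their common initial
   segment isolates the next coefficient. *)
Lemma esum_power_coef_le (R : realType) (a b : nat -> R) l :
  (forall n, 0 <= a n) -> (forall n, 0 <= b n) ->
  (forall x, 0 < x < 1 -> (\esum_(n in [set: nat]) (x ^+ n * a n)%:E =
     \esum_(n in [set: nat]) (x ^+ n * b n)%:E)%E) ->
  (\esum_(n in [set: nat]) (2^-1 ^+ n * b n)%:E < +oo)%E ->
  (forall i, (i < l)%N -> a i = b i) -> a l <= b l.
Proof.
move=> a0 b0 ab bfin abl.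
have t0 (x : R) c n : 0 <= x -> 0 <= c -> (0 <= (x ^+ n * c)%:E)%E.
  by move=> *; rewrite lee_fin mulr_ge0 ?exprn_ge0.
have h0 : 0 <= 2^-1 :> R by rewrite invr_ge0.
have s0 : (0 <= \esum_(n in [set: nat]) (2^-1 ^+ n * b n)%:E)%E.
  by apply: esum_ge0 => n _; exact: t0.
set M := fine (\esum_(n in [set: nat]) (2^-1 ^+ n * b n)%:E)%E.
have ME : (\esum_(n in [set: nat]) (2^-1 ^+ n * b n)%:E = M%:E)%E.
  by rewrite fineK// ge0_fin_numE.
have M0 : 0 <= M by rewrite fine_ge0.
have key x : 0 < x -> x <= 2^-1 -> x ^+ l * a l <= x ^+ l * b l + (2 * x) ^+ l.+1 * M.
  move=> x0 x12; have x_ge0 := ltW x0.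
  have x2 : 2 * x <= 1 by lra.
  suff : \sum_(i < l.+1) x ^+ i * a i <=
      \sum_(i < l.+1) x ^+ i * b i + (2 * x) ^+ l.+1 * M.
    rewrite !big_ord_recr/=; under eq_bigr => i _ do rewrite abl//.
    by rewrite -addrA lerD2l.
  rewrite -lee_fin EFinD -!sumEFin.
  rewrite -(@esum_ord _ _ (fun i => (x ^+ i * a i)%:E)) => [|i _]; last exact: t0.
  rewrite -(@esum_ord _ _ (fun i => (x ^+ i * b i)%:E)) => [|i _]; last exact: t0.
  apply: (@le_trans _ _ (\esum_(n in [set: nat]) (x ^+ n * a n)%:E)%E).
    rewrite esum_mkcond; apply: le_esum => n _.
    by case: ifP => // _; exact: t0.
  rewrite ab ?x0/=; last by lra.
  rewrite EFinM -ME -esumZl ?exprn_ge0 ?mulr_ge0//; last by move=> n _; exact: t0.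
  rewrite [X in (_ <= X + _)%E]esum_mkcond -esumD; last 2 first.
  - by move=> n _; case: ifP => // _; exact: t0.
  - by move=> n _; rewrite mule_ge0 ?t0// lee_fin exprn_ge0 ?mulr_ge0.
  apply: le_esum => n _; case: ifPn => [_|].
    by rewrite leeDl// mule_ge0 ?t0// lee_fin exprn_ge0 ?mulr_ge0.
  rewrite notin_setE /= => /negP; rewrite -leqNgt => ln.
  rewrite add0e -EFinM lee_fin mulrA ler_wpM2r//.
  (* Here [n] exceeds [l] and [2 * x <= 1], so [(2 * x) ^+ n] is at most [(2 * x) ^+ l.+1]; the
     remaining factors are terms of the series with sum [M]. *)
  rewrite (_ : x ^+ n = (2 * x) ^+ n * 2^-1 ^+ n); last first.
    by rewrite -exprMn mulrAC divff ?mul1r.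
  by rewrite ler_wpM2r ?exprn_ge0// ler_wiXn2l// mulr_ge0.
apply/ler_addgt0Pr => e e0.
pose K := 2 ^+ l.+1 * M.
have K0 : 0 <= K by rewrite mulr_ge0 ?exprn_ge0.
(* Chosen so that [K * x <= e]; the denominator [K + 1] stays positive even if [M] is 0. *)
pose x := Num.min 2^-1 (e / (K + 1)).
have K1 : 0 < K + 1 by rewrite ltr_wpDl.
have x0 : 0 < x by rewrite lt_min invr_gt0 divr_gt0 ?ltr0n.
have xe : K * x <= e.
  apply: (@le_trans _ _ ((K + 1) * x)); first by rewrite ler_wpM2r ?ltW// ltrDl.
  by rewrite mulrC -ler_pdivlMr// ge_min lexx orbT.
have xh : x <= 2^-1 by rewrite ge_min lexx.
rewrite -(ler_pM2l (exprn_gt0 l x0)) (le_trans (key x x0 xh))// mulrDr lerD2l.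
rewrite exprMn [x ^+ l.+1]exprSr (_ : _ * M = x ^+ l * (K * x)); last by rewrite /K; ring.
by rewrite ler_pM2l ?exprn_gt0.
Qed.

Lemma esum_power_coef_inj (R : realType) (a b : nat -> R) :
  (forall n, 0 <= a n) -> (forall n, 0 <= b n) ->
  (forall x, 0 < x < 1 -> (\esum_(n in [set: nat]) (x ^+ n * a n)%:E =
     \esum_(n in [set: nat]) (x ^+ n * b n)%:E)%E) ->
  (\esum_(n in [set: nat]) (2^-1 ^+ n * b n)%:E < +oo)%E ->
  a =1 b.
Proof.
move=> a0 b0 ab bfin n; have h : 0 < (2^-1 : R) < 1 by rewrite invr_gt0 invf_lt1 ?ltr1n ?ltr0n.
elim/ltn_ind: n => l IH; apply/eqP; rewrite eq_le; apply/andP; split.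
  exact: esum_power_coef_le.
(* With the roles exchanged, finiteness at 1/2 is carried over to [a] by [ab]. *)
apply: esum_power_coef_le => // [x x01||i /IH//]; first by rewrite ab.
by rewrite ab.
Qed.

(** * Block decompositions and admissibility of the dual *)

(** Leading ones are allowed so that the induction applies to tails: an entry 1 lengthens the
    initial run, and a larger entry closes that run into a block. *)
Lemma is_index_blocks k : is_index k ->
  exists b ab, all (fun p => (0 < p.1) && (0 < p.2))%N ab /\
    k = nseq b 1%N ++ of_blocks ab.
Proof.
elim: k => [_|k1 k IH /= /andP[k1_gt0 /IH[b [ab [ab0 ->]]]]].
  by exists 0%N, [::].
case: k1 k1_gt0 => [//|[|k1] _]; first by exists b.+1, ab.
exists 0%N, ((k1.+1, b.+1) :: ab); split => //.
by rewrite /of_blocks /= addn1 subn1.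
Qed.

Lemma admissible_blocks k : admissible k -> exists ab, is_block_decomposition k ab.
Proof.
move=> /andP[/is_index_blocks[[|b] [ab [ab0 ->]]] k2]; last by [].
by exists ab.
Qed.

Lemma admissible_dual ab : all (fun p => (0 < p.1) && (0 < p.2))%N ab ->
  ab != [::] -> admissible (dual_blocks ab).
Proof.
move=> ab0 abn; apply/andP; split.
  apply/allP => y /flattenP[_ /mapP[p _ ->]].
  by rewrite inE addn1 => /predU1P[->//|]; rewrite mem_nseq => /andP[_ /eqP ->].
(* The dual begins with the block of the last pair, so its head is [b + 1]. *)
case/lastP: ab abn ab0 => // ab [a b] _; rewrite all_rcons /= => /andP[/andP[_ b0] _].
by rewrite /dual_blocks rev_rcons /= addn1.
Qed.

(** * Generating functions of the shifted sums, their finiteness, and the conclusion *)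

Section Ohno.
Variables (R : realType) (q : R).
Hypotheses (q0 : 0 < q) (q1 : q < 1).

Lemma zetaqE k : admissible k ->
  (\esum_(n in decr_seqs (size k)) (zetaq_term q k n)%:E = (zetaq q k)%:E)%E.
Proof.
move=> kadm; rewrite fineK// ge0_fin_numE ?zetaq_cvg//.
by apply: esum_ge0 => n [nk _ n0]; rewrite lee_fin zetaq_term_ge0.
Qed.

Lemma zetaq_ge0 k : 0 <= zetaq q k.
Proof.
apply: fine_ge0; apply: esum_ge0 => n [nk _ n0].
by rewrite lee_fin zetaq_term_ge0.
Qed.

Lemma shifted_zetaq_sum_ge0 k l : 0 <= shifted_zetaq_sum q k l.
Proof. by apply: sumr_ge0 => c _; exact: zetaq_ge0. Qed.

Lemma admissible_addseq k c : size c = size k -> admissible k ->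
  admissible (addseq k c).
Proof.
case: k c => [|k1 k] [|c1 c]//= [ck] /andP[/= /andP[k1_gt0 kidx] k12].
apply/andP; split => /=; last by rewrite (leq_trans k12)// leq_addr.
rewrite addn_gt0 k1_gt0 /= /is_index all_map.
elim: k c ck kidx {k12 k1_gt0} => [|k2 k IH] [|c2 c]//= [ck] /andP[k20 kidx].
by rewrite addn_gt0 k20 IH.
Qed.

Lemma addseq_ffun k l (c : {ffun 'I_(size k) -> 'I_l}) :
  [seq (nth 0 k i + c i)%N | i : 'I_(size k)] =
  addseq k [seq nat_of_ord (c i) | i : 'I_(size k)].
Proof.
have kE : k = [seq nth 0%N k (val i) | i : 'I_(size k)].
  by rewrite -[LHS](mkseq_nth 0%N) /mkseq -val_enum_ord -map_comp.
transitivity ([seq (p.1 + p.2)%N | p <-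
    zip [seq nth 0%N k (val i) | i : 'I_(size k)] [seq nat_of_ord (c i) | i : 'I_(size k)]]).
  by rewrite zip_map -map_comp.
by rewrite -kE.
Qed.

Lemma esum_shifted_zetaq_sum k (x : R) : admissible k -> 0 <= x ->
  (\esum_(l in [set: nat]) (x ^+ l * shifted_zetaq_sum q k l)%:E =
   \esum_(c in [set c | size c = size k]) ((x ^+ sumn c)%:E *
     \esum_(n in decr_seqs (size k)) (zetaq_term q (addseq k c) n)%:E))%E.
Proof.
move=> kadm x0.
transitivity (\esum_(c in [set c | size c = size k])
    (x ^+ sumn c * zetaq q (addseq k c))%:E)%E; last first.
  apply: eq_esum => c /= ck; rewrite -(size_addseq ck) zetaqE//.
  exact: admissible_addseq.
(* Shift sequences are grouped by their total [l]; those of total [l] are matched with the finite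
   functions in [shifted_zetaq_sum]. *)
rewrite (@esum_fibers _ _ _ _ [set: nat] sumn)// => [|c _]; last first.
  by rewrite lee_fin mulr_ge0 ?exprn_ge0 ?zetaq_ge0.
apply: eq_esum => l _.
rewrite (@reindex_esum _ _ _
  [set c : {ffun 'I_(size k) -> 'I_l.+1} | (\sum_i c i)%N == l] _
  (fun c => [seq nat_of_ord (c i) | i : 'I_(size k)])); last first.
  split.
  - move=> c /= /eqP cl; rewrite size_image card_ord; split => //.
    by rewrite sumnE big_image.
  - move=> c c' _ _ cc'; apply/ffunP => i; apply/val_inj.
    by move/eq_in_map: cc' => /(_ i); rewrite mem_enum; exact.
  (* No entry of [c] exceeds the total [l], so [inord] loses nothing. *)
  - move=> c [/= ck cl]; pose d := [ffun i : 'I_(size k) => inord (nth 0 c i) : 'I_l.+1].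
    have dE : [seq nat_of_ord (d i) | i : 'I_(size k)] = c.
      rewrite -[RHS](mkseq_nth 0%N) ck /mkseq -val_enum_ord -map_comp.
      apply: eq_map => i /=; rewrite ffunE inordK// ltnS -cl sumnE.
      by rewrite (big_nth 0%N) big_mkord (bigD1 (cast_ord (esym ck) i))//= leq_addr.
    by exists d => //=; apply/eqP; apply: etrans cl; rewrite -dE sumnE big_image.
rewrite esum_big_enum => [|c _]; last first.
  by rewrite lee_fin mulr_ge0 ?exprn_ge0 ?zetaq_ge0.
rewrite sumEFin /shifted_zetaq_sum mulr_sumr; congr EFin.
apply: eq_bigr => c /eqP cl; rewrite addseq_ffun sumnE big_image.
by rewrite cl.
Qed.

(** From [q ^+ n <= 1 <= qint q n] one gets [(1 - x) * qint q n <= qintx q x n]. This reduces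
    finiteness of the generating function to that of [zetaq]. *)
Lemma ohno_weight_le x k n : 0 <= x -> x < 1 -> (0 < k)%N -> (0 < n)%N ->
  ohno_weight q x k n <= (1 - x)^-1 * zeta_weight q k n.
Proof.
move=> x0 x1; case: k => // k _ n0; rewrite /ohno_weight /zeta_weight subn1 /=.
have N1 := qint_ge1 q0 q1 n0; have N0 := qint_gt0 q0 q1 n0.
have M0 := qintx_gt0 q0 q1 x0 x1 n0.
have NM : (1 - x) * qint q n <= qintx q x n.
  rewrite mulrBl mul1r lerB// ler_wpM2l// (le_trans _ N1)// exprn_ile1// ltW//.
have x10 : 0 < 1 - x by rewrite subr_gt0.
rewrite mulrCA -invfM ler_wpM2l ?exprn_ge0 ?(ltW q0)//.
rewrite lef_pV2 ?posrE; last 2 first.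
- by apply: mulr_gt0 => //; rewrite exprn_gt0.
- by apply: mulr_gt0 => //; rewrite exprn_gt0.
by rewrite exprSr mulrCA ler_wpM2l// exprn_ge0// ltW.
Qed.

Lemma nested_weight_le x k n : 0 <= x -> x < 1 -> is_index k ->
  nested (ohno_weight q x) k n <=
  (1 - x)^-1 ^+ size k * nested (zeta_weight q) k n.
Proof.
move=> x0 x1; elim: k n => [|k1 k IH] n; first by rewrite mul1r.
move=> /= /andP[k1_gt0 kidx].
have [->|n0] := posnP n; first by rewrite !big_ord0 !mulr0.
rewrite exprS mulrACA ler_pM ?ohno_weight_ge0 ?ohno_weight_le//.
  by rewrite sumr_ge0// => m _; apply: nested_ge0 => *; exact: ohno_weight_ge0.
by rewrite mulr_sumr ler_sum// => m _; exact: IH.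
Qed.

Lemma esum_nested_weight_fin x k : 0 <= x -> x < 1 -> admissible k ->
  (\esum_(n in [set: nat]) (nested (ohno_weight q x) k n)%:E < +oo)%E.
Proof.
move=> x0 x1 kadm; have /andP[kidx _] := kadm.
have c0 : 0 <= (1 - x)^-1 ^+ size k by rewrite exprn_ge0// invr_ge0 subr_ge0 ltW.
apply: (@le_lt_trans _ _ (((1 - x)^-1 ^+ size k)%:E *
   \esum_(n in [set: nat]) (nested (zeta_weight q) k n)%:E)%E).
  rewrite -esumZl// => [|n _].
    by apply: le_esum => n _; rewrite -EFinM lee_fin nested_weight_le.
  by rewrite lee_fin nested_ge0//; exact: zeta_weight_ge0.
by rewrite -esum_zetaq_term// zetaqE// -EFinM ltry.
Qed.

Lemma generating_shifted_zetaq_sum x k : 0 <= x -> x < 1 -> admissible k ->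
  (\esum_(l in [set: nat]) (x ^+ l * shifted_zetaq_sum q k l)%:E =
   connected_sum q x k [::])%E.
Proof.
move=> x0 x1 kadm; rewrite connected_sum_nil// esum_shifted_zetaq_sum//.
by rewrite esum_shifted_zetaq_terms//; case/andP: kadm.
Qed.

End Ohno.

Theorem theorem2 (R : realType) (q : R) (q0 : 0 < q) (q1 : q < 1)
    (k : seq nat) (kadm : admissible k) :
  (exists ab : seq (nat * nat), is_block_decomposition k ab) /\
  (forall k' : seq nat, is_dual k k' ->
     forall l : nat, shifted_zetaq_sum q k l = shifted_zetaq_sum q k' l).
Proof.
split; first exact: admissible_blocks.
move=> k' [ab [ab0 kE] ->].
(* An empty decomposition would make [k] empty, hence not admissible. *)
have k'adm : admissible (dual_blocks ab).
  by apply: admissible_dual => //; apply: contraTneq kadm => abE; rewrite kE abE.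
have [h0 h1] : 0 <= (2^-1 : R) /\ (2^-1 : R) < 1 by split; lra.
apply: esum_power_coef_inj.
- by move=> l; exact: shifted_zetaq_sum_ge0.
- by move=> l; exact: shifted_zetaq_sum_ge0.
- move=> x /andP[/ltW x0 x1].
  (* All blocks of [k] cross to the right, leaving the empty index on the left; symmetry then gives
     the generating function of the dual. *)
  rewrite !generating_shifted_zetaq_sum// kE connected_sum_blocks// cats0.
  exact: connected_sumC.
- rewrite generating_shifted_zetaq_sum// connected_sum_nil//.
  exact: esum_nested_weight_fin.
Qed.
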